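(* Let $V$ be a real vector space with $\dim V=3$ and let $\{e_1,e_2,e_3\}$ be a basis of $V$. Let $\mathbb{Z}_2^{\,3}$ act on $V$ as the group generated by $Q_1,Q_2,Q_3\in\mathrm{End}(V)$, which with respect to this basis are represented by the matrices $Q_1=\mathrm{diag}(-1,1,1)$, $Q_2=\mathrm{diag}(1,-1,1)$, $Q_3=\mathrm{diag}(1,1,-1)$, and consider the induced action on $W^*$. Let $M\in(W^* )^{\mathbb{Z}_2^{\,3}}$ be an invariant element. Then $M\in\mathcal{C}_W^*$ if and only if $M$ satisfies the elastic bounds, i.e. $M(\alpha\otimes\beta,\alpha\otimes\beta)\ge0$ for all $\alpha,\beta\in V^*$.
   Context: $W:=\{S\in \mathrm{Sym}^2(\mathrm{Sym}^2V^* )\oplus\mathrm{Sym}^2(\Lambda^2V^* ):\tau S=S\}\subset (V^* )^{\otimes 4}$, where $(\tau S)(v_1,v_2,v_3,v_4)=S(v_1,v_4,v_3,v_2)$. Each $S\in W$ is regarded as a symmetric bilinear form on $V\otimes V$ via $S(a\otimes b,c\otimes d)=S(a,b,c,d)$, and $\mathcal{C}_W:=\{S\in W:S\ge0\}$ is the cone of positive semi-definite elements. The dual space $W^*$ is identified, via the natural pairing of $V^{\otimes 4}$ with $(V^* )^{\otimes 4}$, with the space of tensors $M\in V^{\otimes 4}$ having the same symmetries, i.e. $M\in\mathrm{Sym}^2(\mathrm{Sym}^2V)\oplus\mathrm{Sym}^2(\Lambda^2V)$ and $M$ is invariant under exchanging its second and fourth tensor factors. Such an $M$ is also viewed as a symmetric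 bilinear form on $V^*\otimes V^*$. The dual cone is $\mathcal{C}_W^*:=\{M\in W^*: M(S)\ge0\ \text{for all } S\in\mathcal{C}_W\}$, where $M(S)$ is the natural pairing. For a group $G$ acting on $W^*$, $(W^* )^G$ denotes the subspace of $G$-invariant elements. *)

(* Defs.v *)
From HB Require Import structures.
From mathcomp Require Import all_boot all_order all_algebra all_reals.
Set Implicit Arguments.
Unset Strict Implicit.
Unset Printing Implicit Defensive.
Import GRing.Theory.
Local Open Scope ring_scope.

Definition dual (R : realType) (U : vectType R) : vectType R := 'Hom(U, R^o).

(* (U^* )^{⊗4} as the space of quadrilinear forms on U, in curried form. With
   U := dual V it is V^{⊗4}, the pure tensor v1⊗v2⊗v3⊗v4 being the form
   (a1, a2, a3, a4) |-> a1 v1 * a2 v2 * a3 v3 * a4 v4. *)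
Definition tensor4 (R : realType) (U : vectType R) : vectType R :=
  'Hom(U, 'Hom(U, 'Hom(U, 'Hom(U, R^o)))).

Definition ev4 (R : realType) (U : vectType R) (S : tensor4 U) (a b c d : U) : R :=
  S a b c d.

Section Symmetries.
Variables (R : realType) (U : vectType R).
Implicit Types S : tensor4 U.

Definition in_Sym2Sym2 S : Prop :=
  [/\ forall a b c d, ev4 S b a c d = ev4 S a b c d,
      forall a b c d, ev4 S a b d c = ev4 S a b c d
    & forall a b c d, ev4 S c d a b = ev4 S a b c d].

Definition in_Sym2Alt2 S : Prop :=
  [/\ forall a b c d, ev4 S b a c d = - ev4 S a b c d,
      forall a b c d, ev4 S a b d c = - ev4 S a b c d
    & forall a b c d, ev4 S c d a b = ev4 S a b c d].

(* Membership in W when U = V, and in W^* when U = dual V. *)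
Definition in_W S : Prop :=
  (exists A B, [/\ in_Sym2Sym2 A, in_Sym2Alt2 B & S = A + B]) /\
  (forall a b c d, ev4 S a d c b = ev4 S a b c d).

(* Elements of U⊗U are presented as finite sums of pure tensors: the sequence
   x stands for the sum of p.1⊗p.2 over p in x. The value of S on (x, y)
   depends only on the elements of U⊗U that x and y present. *)
Definition form2 S (x y : seq (U * U)) : R :=
  \sum_(p <- x) \sum_(q <- y) ev4 S p.1 p.2 q.1 q.2.

Definition psd S : Prop := forall x : seq (U * U), 0 <= form2 S x x.

Definition in_CW S : Prop := in_W S /\ psd S.

End Symmetries.

Section Pairing.
Variables (R : realType) (V : vectType R).
Implicit Types (S : tensor4 V) (M : tensor4 (dual V)).

Definition dual_vec n (b : n.-tuple V) (i : 'I_n) : dual V :=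
  linfun (coord b i : V -> R^o).

Definition pairing_on n (b : n.-tuple V) M S : R :=
  \sum_i \sum_j \sum_k \sum_l
    ev4 M (dual_vec b i) (dual_vec b j) (dual_vec b k) (dual_vec b l)
    * ev4 S b`_i b`_j b`_k b`_l.

(* The natural pairing M(S) of V^{⊗4} with (V^* )^{⊗4}. It does not depend on
   the basis (pairing_basisE), and evaluates S on pure tensors
   (pairing_pure). *)
Definition pairing M S : R := pairing_on (vbasis {:V}) M S.

Definition in_dual_CW M : Prop :=
  in_W M /\ forall S, in_CW S -> 0 <= pairing M S.

Definition elastic_bounds M : Prop :=
  forall a b : dual V, 0 <= form2 M [:: (a, b)] [:: (a, b)].

End Pairing.

Section Action.
Variables (R : realType) (V : vectType R).

(* The subgroup generated by the Q i; the library's g^-1%VF is the inverse of g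
   when g is bijective. *)
Inductive generated_by (I : Type) (Q : I -> 'End(V)) : 'End(V) -> Prop :=
| gen_id : generated_by Q \1%VF
| gen_gen i : generated_by Q (Q i)
| gen_inv g : generated_by Q g -> generated_by Q (g^-1)%VF
| gen_comp g h : generated_by Q g -> generated_by Q h -> generated_by Q (g \o h)%VF.

(* The induced action of g on V^{⊗4} sends v1⊗v2⊗v3⊗v4 to
   g v1⊗g v2⊗g v3⊗g v4, i.e. precomposes all four arguments with g. *)
Definition act_fixes (g : 'End(V)) (M : tensor4 (dual V)) : Prop :=
  forall a b c d : dual V,
    ev4 M (a \o g)%VF (b \o g)%VF (c \o g)%VF (d \o g)%VF = ev4 M a b c d.

Definition tensor_invariant (G : 'End(V) -> Prop) (M : tensor4 (dual V)) : Prop :=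
  forall g, G g -> act_fixes g M.

(* Column convention: g e_j = \sum_i (matrix_in e g) i j *: e_i. *)
Definition matrix_in n (e : n.-tuple V) (g : 'End(V)) : 'M[R]_n :=
  \matrix_(i, j) coord e i (g e`_j).

End Action.

Section Facts.
Variables (R : realType) (V : vectType R).
Implicit Types (S : tensor4 V) (M : tensor4 (dual V)).

Lemma dual_vecE n (b : n.-tuple V) i v : dual_vec b i v = coord b i v.
Proof. by rewrite /dual_vec lfunE. Qed.

Lemma dual_expand n (b : n.-tuple V) (a : dual V) :
  basis_of {:V} b -> a = \sum_(i < n) (a b`_i : R) *: dual_vec b i.
Proof.
move=> bb; apply/lfunP => v; rewrite {1}(coord_basis bb (memvf v)) linear_sum.
rewrite sum_lfunE; apply: eq_bigr => i _.
by rewrite linearZ scale_lfunE dual_vecE /GRing.scale /= mulrC.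
Qed.

Lemma trace_basisE n m (b : n.-tuple V) (e : m.-tuple V)
    (G : V -> dual V -> R) :
  (forall a, linear (fun v => G v a : R^o)) ->
  (forall v, linear (fun a => G v a : R^o)) ->
  basis_of {:V} b -> basis_of {:V} e ->
  \sum_(i < n) G b`_i (dual_vec b i) = \sum_(i < m) G e`_i (dual_vec e i).
Proof.
move=> G1 G2 bb be.
pose A a := GRing.isLinear.Build R V R^o _ (fun v => G v a : R^o) (G1 a).
pose A' a : {linear V -> R^o} := HB.pack (fun v => G v a : R^o) (A a).
pose B v := GRing.isLinear.Build R (dual V) R^o _ (fun a => G v a : R^o) (G2 v).
pose B' v : {linear dual V -> R^o} := HB.pack (fun a => G v a : R^o) (B v).
have z1 a k v : G (k *: v) a = k * G v a by exact: (linearZ_LR (A' a)).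
have z2 v k a : G v (k *: a) = k * G v a by exact: (linearZ_LR (B' v)).
have s1 a p (F : 'I_p -> V) : G (\sum_i F i) a = \sum_i G (F i) a.
  exact: (linear_sum (A' a)).
have s2 v p (F : 'I_p -> dual V) : G v (\sum_i F i) = \sum_i G v (F i).
  exact: (linear_sum (B' v)).
transitivity
  (\sum_(i < n) \sum_(k < m) coord e k b`_i * G e`_k (dual_vec b i)).
  apply: eq_bigr => i _; rewrite {1}(coord_basis be (memvf b`_i)) s1.
  by apply: eq_bigr => k _; rewrite z1.
rewrite exchange_big /=; apply: eq_bigr => k _.
rewrite [in RHS](dual_expand (dual_vec e k) bb) s2; apply: eq_bigr => i _.
by rewrite z2 dual_vecE.
Qed.

Section Linear4.
Variables (U : vectType R) (T : tensor4 U) (k : R) (x y a b c : U).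

Lemma ev4_linear1 :
  ev4 T (k *: x + y) a b c = k * ev4 T x a b c + ev4 T y a b c.
Proof. by rewrite /ev4 linearP !(add_lfunE, scale_lfunE). Qed.

Lemma ev4_linear2 :
  ev4 T a (k *: x + y) b c = k * ev4 T a x b c + ev4 T a y b c.
Proof. by rewrite /ev4 linearP !(add_lfunE, scale_lfunE). Qed.

Lemma ev4_linear3 :
  ev4 T a b (k *: x + y) c = k * ev4 T a b x c + ev4 T a b y c.
Proof. by rewrite /ev4 linearP !(add_lfunE, scale_lfunE). Qed.

Lemma ev4_linear4 :
  ev4 T a b c (k *: x + y) = k * ev4 T a b c x + ev4 T a b c y.
Proof. by rewrite /ev4 linearP. Qed.

End Linear4.

Lemma pairing_on_basisE n m (b : n.-tuple V) (e : m.-tuple V) M S :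
  basis_of {:V} b -> basis_of {:V} e -> pairing_on b M S = pairing_on e M S.
Proof.
move=> bb be; rewrite /pairing_on.
have sumP I (r : seq I) (F G : I -> R) (k : R) :
    \sum_(i <- r) (k * F i + G i) = k * \sum_(i <- r) F i + \sum_(i <- r) G i.
  by rewrite big_split mulr_sumr.
pose D := dual_vec b; pose E := dual_vec e.
apply: (etrans (trace_basisE (G := fun v a => \sum_j \sum_k \sum_l
    ev4 M a (D j) (D k) (D l) * ev4 S v b`_j b`_k b`_l) _ _ bb be)).
- move=> a r x y; rewrite /GRing.scale /=; do 3!(rewrite -sumP; apply: eq_bigr => ? _).
  by rewrite ev4_linear1 mulrDr mulrCA.
- move=> v r x y; rewrite /GRing.scale /=; do 3!(rewrite -sumP; apply: eq_bigr => ? _).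
  by rewrite ev4_linear1 mulrDl mulrA.
apply: eq_bigr => i _.
apply: (etrans (trace_basisE (G := fun v a => \sum_k \sum_l
    ev4 M (E i) a (D k) (D l) * ev4 S e`_i v b`_k b`_l) _ _ bb be)).
- move=> a r x y; rewrite /GRing.scale /=; do 2!(rewrite -sumP; apply: eq_bigr => ? _).
  by rewrite ev4_linear2 mulrDr mulrCA.
- move=> v r x y; rewrite /GRing.scale /=; do 2!(rewrite -sumP; apply: eq_bigr => ? _).
  by rewrite ev4_linear2 mulrDl mulrA.
apply: eq_bigr => j _.
apply: (etrans (trace_basisE (G := fun v a => \sum_l
    ev4 M (E i) (E j) a (D l) * ev4 S e`_i e`_j v b`_l) _ _ bb be)).
- move=> a r x y; rewrite /GRing.scale /= -sumP; apply: eq_bigr => ? _.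
  by rewrite ev4_linear3 mulrDr mulrCA.
- move=> v r x y; rewrite /GRing.scale /= -sumP; apply: eq_bigr => ? _.
  by rewrite ev4_linear3 mulrDl mulrA.
apply: eq_bigr => k _.
apply: (etrans (trace_basisE (G := fun v a =>
    ev4 M (E i) (E j) (E k) a * ev4 S e`_i e`_j e`_k v) _ _ bb be)) => //.
- by move=> a r x y; rewrite /GRing.scale /= ev4_linear4 mulrDr mulrCA.
- by move=> v r x y; rewrite /GRing.scale /= ev4_linear4 mulrDl mulrA.
Qed.

Lemma pairing_basisE n (e : n.-tuple V) M S :
  basis_of {:V} e -> pairing M S = pairing_on e M S.
Proof. exact: pairing_on_basisE (vbasisP _). Qed.

Lemma pairing_pure (v1 v2 v3 v4 : V) M S :
  (forall a b c d : dual V, ev4 M a b c d = a v1 * b v2 * c v3 * d v4 :> R) ->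
  pairing M S = ev4 S v1 v2 v3 v4.
Proof.
move=> ME; rewrite /pairing /pairing_on.
set b := vbasis _; have X v : v = \sum_(i < _) coord b i v *: b`_i.
  exact: coord_vbasis (memvf v).
have Z3 k x a c d : S a c (k *: x) d = k *: S a c x d.
  by rewrite linearZ_LR scale_lfunE.
have Z4 k x a c d : S a c d (k *: x) = k *: S a c d x by rewrite linearZ_LR.
rewrite /ev4 in ME *.
rewrite [in RHS](X v1) linear_sum !sum_lfunE; apply: eq_bigr => i _.
rewrite [in RHS]linearZ_LR !scale_lfunE [in RHS](X v2) linear_sum !sum_lfunE.
rewrite scaler_sumr; apply: eq_bigr => j _.
rewrite [in RHS]linearZ_LR !scale_lfunE [in RHS](X v3) linear_sum !sum_lfunE.
rewrite !scaler_sumr; apply: eq_bigr => k _.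
rewrite Z3 [in RHS](X v4) linear_sum !scaler_sumr; apply: eq_bigr => l _.
by rewrite /= Z4 ME !dual_vecE /GRing.scale /= !mulrA.
Qed.

End Facts.

(* Main.v *)
(* Invariance under the sign changes leaves only the components p_i = M_iiii,
   q_ij = M_ijij and r_ij = M_iijj of M. If S is positive semi-definite, then so
   is the 3x3 matrix U = (S_iijj), and S_ijij >= |U_ij|; as the elastic bounds
   give q_ij >= 0, M(S) is at least
     G(U) = sum_i p_i U_ii + 2 sum_(i < j) (q_ij |U_ij| + 2 r_ij U_ij).
   The elastic bounds say exactly that G >= 0 on rank one matrices U. This extends
   to all U >= 0: if U_12 U_13 U_23 <= 0, the bounds for pairs of indices give
   G(U) >= y^T U y for a vector y with entries ± sqrt p_i; if U_12 U_13 U_23 > 0,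
   some Cholesky step splits U into a rank one matrix and a 2x2 block without
   cancellation in the off-diagonal entries, and G is additive on such a splitting.
   The converse implication tests M on the projection to W of (a⊗b)^2. *)
From HB Require Import structures.
Require Import Defs.
From mathcomp Require Import all_boot all_order all_algebra all_reals.
From mathcomp Require Import ring lra.
Set Implicit Arguments.
Unset Strict Implicit.
Unset Printing Implicit Defensive.
Import Order.TTheory GRing.Theory Num.Theory.
Local Open Scope ring_scope.

(** * Nonnegativity of the gauge on positive semi-definite 3x3 matrices *)

Section Cone.
Variable R : rcfType.
Implicit Types p q r u x y z t : R.

Definition quad2 u1 u2 u12 x y := u1 * x ^+ 2 + u2 * y ^+ 2 + 2 * u12 * x * y.

Definition quad3 u1 u2 u3 u12 u13 u23 x y z :=
  u1 * x ^+ 2 + u2 * y ^+ 2 + u3 * z ^+ 2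
  + 2 * (u12 * x * y + u13 * x * z + u23 * y * z).

(** Half the contribution of a pair i < j: the orbit of ijij has two entries and that of iijj has
    four, hence the factor 2 on [r]. *)
Definition twist q r t := q * `|t| + 2 * r * t.

(* The pairing of the invariant M with components M_iiii = p_i, M_ijij = q_ij,
   M_iijj = r_ij with S such that S_iijj = u_ij and S_ijij = |u_ij|, the least
   value of S_ijij compatible with S >= 0. *)
Definition gauge p1 p2 p3 q12 q13 q23 r12 r13 r23 u1 u2 u3 u12 u13 u23 :=
  p1 * u1 + p2 * u2 + p3 * u3
  + 2 * (twist q12 r12 u12 + twist q13 r13 u13 + twist q23 r23 u23).

Lemma sign_norm t : exists2 s : R, s ^+ 2 = 1 & s * t = `|t|.
Proof. by case: (ger0P t) => h; [exists 1 | exists (-1)]; ring. Qed.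

Lemma norm_sqr1 t : t ^+ 2 = 1 -> `|t| = 1.
Proof. by move=> t1; apply/eqP; rewrite -(@pexpr_eq1 _ _ 2) // -normrX t1 normr1. Qed.

Lemma twist0 q r : twist q r 0 = 0.
Proof. by rewrite /twist normr0 !mulr0 addr0. Qed.

Lemma twistD q r t t' : 0 <= t * t' -> twist q r (t + t') = twist q r t + twist q r t'.
Proof.
move=> tt; suff E : `|t + t'| = `|t| + `|t'| by rewrite /twist E; ring.
case: (ger0P t) => h; case: (ger0P t') => h'; case: (ger0P (t + t')) => h''; nra.
Qed.

(** If m < 0 and p1 > 0, the point (-m, p1) lies in the quadrant and the form there equals p1 (p1 p2
    - m^2). If p1 = 0, the value at (p2 + 1, -m) is -(p2 + 2) m^2 < 0. *)
Lemma copositive2 p1 p2 m : 0 <= p1 -> 0 <= p2 ->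
  (forall x y, 0 <= x -> 0 <= y -> 0 <= quad2 p1 p2 m x y) ->
  - (Num.sqrt p1 * Num.sqrt p2) <= m.
Proof.
rewrite /quad2 => p1_ge0 p2_ge0 H.
have s1 := sqrtr_ge0 p1; have s2 := sqrtr_ge0 p2.
case: (lerP 0 m) => m0; first by apply: le_trans m0; rewrite oppr_le0 mulr_ge0.
have h : m ^+ 2 <= p1 * p2.
  move: p1_ge0; rewrite le_eqVlt => /orP[/eqP p10|p1_gt0].
    have := H (p2 + 1) (- m); rewrite -p10 => /(_ ltac:(lra) ltac:(lra)); nra.
  have := H (- m) p1 ltac:(lra) ltac:(lra).
  rewrite (_ : _ + _ = p1 * (p1 * p2 - m ^+ 2)); last by ring.
  by rewrite pmulr_rge0 // subr_ge0.
rewrite lerNl -sqrtrM // -(@ler_pXn2r _ 2) ?nnegrE ?sqrtr_ge0 //; last lra.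
by rewrite sqr_sqrtr ?mulr_ge0 // sqrrN.
Qed.

(** Once the sign s of x y is fixed, [twist] is linear in |x y| with slope q + 2 r s, so the
    hypothesis becomes copositivity on a quadrant. *)
Lemma twist_ge p1 p2 q r : 0 <= p1 -> 0 <= p2 ->
  (forall x y, 0 <= p1 * x ^+ 2 + p2 * y ^+ 2 + 2 * twist q r (x * y)) ->
  forall t, - (Num.sqrt p1 * Num.sqrt p2 * `|t|) <= twist q r t.
Proof.
move=> p1_ge0 p2_ge0 H t.
have [s s1 st] := sign_norm t.
have tE : t = s * `|t| by rewrite -st mulrA -expr2 s1 mul1r.
have : - (Num.sqrt p1 * Num.sqrt p2) <= q + 2 * r * s.
  apply: copositive2 => // x y x0 y0; have := H x (s * y).
  have -> : twist q r (x * (s * y)) = (q + 2 * r * s) * (x * y).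
    rewrite /twist !normrM (norm_sqr1 s1) (ger0_norm x0) (ger0_norm y0); ring.
  by rewrite /quad2 exprMn s1; lra.
move=> /(ler_wpM2r (normr_ge0 t)); rewrite mulNr => /le_trans; apply.
by rewrite /twist {3}tE le_eqVlt; apply/orP; left; apply/eqP; ring.
Qed.

Lemma quad2_discr u1 u2 u12 : (forall x y, 0 <= quad2 u1 u2 u12 x y) ->
  u12 ^+ 2 <= u1 * u2.
Proof.
rewrite /quad2 => H.
have u1_ge0 : 0 <= u1 by have := H 1 0; lra.
move: u1_ge0; rewrite le_eqVlt => /orP[/eqP u10|u1_gt0].
  have := H (- (u2 + 1)) u12; have := H 0 1; rewrite -u10; nra.
have := H (- u12) u1.
rewrite (_ : _ + _ = u1 * (u1 * u2 - u12 ^+ 2)); last by ring.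
by rewrite pmulr_rge0 // subr_ge0.
Qed.

(** At (sqrt p1, -s sqrt p2), with s the sign of u12, the form is p1 u1 + p2 u2 - 2 sqrt p1 sqrt p2
    |u12|, which the twist bound dominates. *)
Lemma pair_nonneg p1 p2 q r u1 u2 u12 : 0 <= p1 -> 0 <= p2 ->
  (forall t, - (Num.sqrt p1 * Num.sqrt p2 * `|t|) <= twist q r t) ->
  (forall x y, 0 <= quad2 u1 u2 u12 x y) ->
  0 <= p1 * u1 + p2 * u2 + 2 * twist q r u12.
Proof.
move=> p1_ge0 p2_ge0 /(_ u12) H psdU.
have [s s1 su] := sign_norm u12.
have := psdU (Num.sqrt p1) (- s * Num.sqrt p2).
rewrite /quad2 exprMn sqrrN s1 !sqr_sqrtr //.
have -> : 2 * u12 * Num.sqrt p1 * (- s * Num.sqrt p2)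
          = - 2 * (Num.sqrt p1 * Num.sqrt p2 * `|u12|) by rewrite -su; ring.
lra.
Qed.

(** Flipping the sign of a vertex preserves the product of the three edges. Two edges can be made
    nonpositive freely; the product, or a vanishing edge, takes care of the third. *)
Lemma triangle_signs u12 u13 u23 : u12 * u13 * u23 <= 0 ->
  exists s1 s2 s3 : R, [/\ s1 ^+ 2 = 1, s2 ^+ 2 = 1 & s3 ^+ 2 = 1] /\
    [/\ s1 * s2 * u12 = - `|u12|, s1 * s3 * u13 = - `|u13|
      & s2 * s3 * u23 = - `|u23|].
Proof.
move=> H.
have [a a1 au] := sign_norm u12; have [b b1 bu] := sign_norm u13.
have [c c1 cu] := sign_norm u23.
have [u120|nz12] := eqVneq u12 0.
  exists (- b), (- c), 1; split; first by rewrite !sqrrN expr1n.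
  by rewrite u120 mulr0 normr0 oppr0 !mulr1 !mulNr bu cu.
have [u130|nz13] := eqVneq u13 0.
  exists (- a), 1, (- c); split; first by rewrite !sqrrN expr1n.
  by rewrite u130 mulr0 normr0 oppr0 !mulr1 !mul1r !mulNr au cu.
exists 1, (- a), (- b); split; first by rewrite !sqrrN expr1n.
rewrite !mul1r !mulNr au bu; split => //.
have [h1 h2] : 0 < `|u12| /\ 0 < `|u13| by rewrite !normr_gt0.
have : 0 <= (`|u12| * `|u13|) * - (a * b * u23).
  rewrite -au -bu (_ : _ * _ = - (a ^+ 2 * b ^+ 2 * (u12 * u13 * u23))); last by ring.
  by rewrite a1 b1 !mul1r oppr_ge0.
rewrite pmulr_rge0 ?mulr_gt0 // oppr_ge0 => /ler0_norm.
by rewrite !normrM (norm_sqr1 a1) (norm_sqr1 b1) !mul1r => ->; ring.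
Qed.

Section Gauge.
Variables p1 p2 p3 q12 q13 q23 r12 r13 r23 : R.

Hypothesis p1_ge0 : 0 <= p1.
Hypothesis p2_ge0 : 0 <= p2.
Hypothesis p3_ge0 : 0 <= p3.
Hypothesis tw12 : forall t, - (Num.sqrt p1 * Num.sqrt p2 * `|t|) <= twist q12 r12 t.
Hypothesis tw13 : forall t, - (Num.sqrt p1 * Num.sqrt p3 * `|t|) <= twist q13 r13 t.
Hypothesis tw23 : forall t, - (Num.sqrt p2 * Num.sqrt p3 * `|t|) <= twist q23 r23 t.

Variables u1 u2 u3 u12 u13 u23 : R.
Hypothesis psdU : forall x y z, 0 <= quad3 u1 u2 u3 u12 u13 u23 x y z.

(* By [tw12], [tw13], [tw23] the gauge is bounded below by the value of the form
   U at (± sqrt p_i), with the signs of [triangle_signs]. *)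
Lemma gauge_ge0_frustrated : u12 * u13 * u23 <= 0 ->
  0 <= gauge p1 p2 p3 q12 q13 q23 r12 r13 r23 u1 u2 u3 u12 u13 u23.
Proof.
move=> /triangle_signs[s1 [s2 [s3 [[e1 e2 e3] [h12 h13 h23]]]]].
have := psdU (s1 * Num.sqrt p1) (s2 * Num.sqrt p2) (s3 * Num.sqrt p3).
rewrite /quad3 !exprMn e1 e2 e3 !sqr_sqrtr //.
rewrite (_ : u12 * _ * _ = s1 * s2 * u12 * (Num.sqrt p1 * Num.sqrt p2)); last by ring.
rewrite (_ : u13 * _ * _ = s1 * s3 * u13 * (Num.sqrt p1 * Num.sqrt p3)); last by ring.
rewrite (_ : u23 * _ * _ = s2 * s3 * u23 * (Num.sqrt p2 * Num.sqrt p3)); last by ring.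
rewrite h12 h13 h23 /gauge; have := tw12 u12; have := tw13 u13; have := tw23 u23; lra.
Qed.

(* Cholesky step at u1: the pivot condition says that the (2,3) entries of the
   rank one part and of the Schur complement both have the sign of u23, so the
   gauge is additive on this decomposition. *)
Lemma gauge_ge0_pivot : 0 < u1 -> 0 < u12 * u13 * u23 ->
  u12 * u13 * u23 <= u23 ^+ 2 * u1 ->
  (forall x y z, 0 <= gauge p1 p2 p3 q12 q13 q23 r12 r13 r23
     (x ^+ 2) (y ^+ 2) (z ^+ 2) (x * y) (x * z) (y * z)) ->
  0 <= gauge p1 p2 p3 q12 q13 q23 r12 r13 r23 u1 u2 u3 u12 u13 u23.
Proof.
move=> u1_gt0 pi_gt0 pivot H.
pose v := Num.sqrt u1.
have v2 : v ^+ 2 = u1 by rewrite sqr_sqrtr // ltW.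
have v0 : v != 0 by rewrite gt_eqF // sqrtr_gt0.
have u10 : u1 != 0 by rewrite gt_eqF.
(* This vector is chosen so that its square has the first row and column of U. *)
have := H v (u12 / v) (u13 / v).
have -> : v * (u12 / v) = u12 by field.
have -> : v * (u13 / v) = u13 by field.
have -> : u12 / v * (u13 / v) = u12 * u13 / u1 by rewrite -v2; field.
have -> : (u12 / v) ^+ 2 = u12 ^+ 2 / u1 by rewrite -v2; field.
have -> : (u13 / v) ^+ 2 = u13 ^+ 2 / u1 by rewrite -v2; field.
rewrite v2.
have : 0 <= p2 * (u2 - u12 ^+ 2 / u1) + p3 * (u3 - u13 ^+ 2 / u1)
            + 2 * twist q23 r23 (u23 - u12 * u13 / u1).
  (* The chosen first coordinate minimizes the form for given y and z, which leaves the Schur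
     complement. *)
  apply: pair_nonneg => // y z; have := psdU (- (u12 * y + u13 * z) / u1) y z.
  by congr (0 <= _); rewrite /quad3 /quad2; field.
have u23_neq0 : u23 != 0 by apply: contraTneq pi_gt0 => ->; rewrite mulr0 ltxx.
have cross_ge0 : 0 <= u12 * u13 / u1 * (u23 - u12 * u13 / u1).
  have -> : u12 * u13 / u1 * (u23 - u12 * u13 / u1)
    = (u12 * u13 * u23) * (u23 ^+ 2 * u1 - u12 * u13 * u23) / (u23 * u1) ^+ 2.
    by field; rewrite u10.
  by rewrite divr_ge0 ?sqr_ge0 // mulr_ge0 ?subr_ge0 // ltW.
have := twistD q23 r23 cross_ge0; rewrite addrC subrK.
rewrite /gauge => ->.
lra.
Qed.

End Gauge.

(** If both inequalities failed, their product would give u13^2 u23^2 u1 u2 < (u12 u13 u23)^2,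
    against u12^2 <= u1 u2. *)
Lemma triangle_pivot u1 u2 u12 u13 u23 : 0 <= u1 -> 0 <= u2 ->
  u12 ^+ 2 <= u1 * u2 -> 0 < u12 * u13 * u23 ->
  u12 * u13 * u23 <= u23 ^+ 2 * u1 \/ u12 * u13 * u23 <= u13 ^+ 2 * u2.
Proof.
move=> u1_ge0 u2_ge0 d12 pi_gt0.
case: (lerP (u12 * u13 * u23) (u23 ^+ 2 * u1)) => h1; first by left.
case: (lerP (u12 * u13 * u23) (u13 ^+ 2 * u2)) => h2; first by right.
have := @ltr_pM _ _ _ _ _ (mulr_ge0 (sqr_ge0 u23) u1_ge0) (mulr_ge0 (sqr_ge0 u13) u2_ge0) h1 h2.
have := ler_wpM2l (sqr_ge0 (u23 * u13)) d12; nra.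
Qed.

Lemma gauge_ge0 p1 p2 p3 q12 q13 q23 r12 r13 r23 :
  (forall x y z, 0 <= gauge p1 p2 p3 q12 q13 q23 r12 r13 r23
     (x ^+ 2) (y ^+ 2) (z ^+ 2) (x * y) (x * z) (y * z)) ->
  forall u1 u2 u3 u12 u13 u23,
  (forall x y z, 0 <= quad3 u1 u2 u3 u12 u13 u23 x y z) ->
  0 <= gauge p1 p2 p3 q12 q13 q23 r12 r13 r23 u1 u2 u3 u12 u13 u23.
Proof.
move=> H u1 u2 u3 u12 u13 u23 psdU.
have p1_ge0 : 0 <= p1.
  by have := H 1 0 0; rewrite /gauge !(mul0r, mulr0, twist0); lra.
have p2_ge0 : 0 <= p2.
  by have := H 0 1 0; rewrite /gauge !(mul0r, mulr0, twist0); lra.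
have p3_ge0 : 0 <= p3.
  by have := H 0 0 1; rewrite /gauge !(mul0r, mulr0, twist0); lra.
have tw12 := @twist_ge p1 p2 q12 r12 p1_ge0 p2_ge0.
(* Rank one matrices with a vanishing coordinate turn [H] into the hypothesis of [twist_ge] for a
   pair of indices. *)
have {}tw12 := tw12 ltac:(by move=> x y; have := H x y 0;
  rewrite /gauge !(mul0r, mulr0, twist0); lra).
have tw13 := @twist_ge p1 p3 q13 r13 p1_ge0 p3_ge0.
have {}tw13 := tw13 ltac:(by move=> x y; have := H x 0 y;
  rewrite /gauge !(mul0r, mulr0, twist0); lra).
have tw23 := @twist_ge p2 p3 q23 r23 p2_ge0 p3_ge0.
have {}tw23 := tw23 ltac:(by move=> x y; have := H 0 x y;
  rewrite /gauge !(mul0r, mulr0, twist0); lra).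
have [le0|gt0] := lerP (u12 * u13 * u23) 0.
  exact: gauge_ge0_frustrated.
have d12 : u12 ^+ 2 <= u1 * u2.
  by apply: quad2_discr => x y; have := psdU x y 0; rewrite /quad3 /quad2; lra.
have u1_ge0 : 0 <= u1 by have := psdU 1 0 0; rewrite /quad3; lra.
have u2_ge0 : 0 <= u2 by have := psdU 0 1 0; rewrite /quad3; lra.
have u12_neq0 : u12 != 0 by apply: contraTneq gt0 => ->; rewrite !mul0r ltxx.
have u1u2_gt0 : 0 < u1 * u2.
  by apply: lt_le_trans d12; rewrite exprn_even_gt0.
have u1_gt0 : 0 < u1.
  by rewrite lt_def u1_ge0 andbT; apply: contraTneq u1u2_gt0 => ->; rewrite mul0r ltxx.
have u2_gt0 : 0 < u2.
  by rewrite lt_def u2_ge0 andbT; apply: contraTneq u1u2_gt0 => ->; rewrite mulr0 ltxx.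
have [h|h] := triangle_pivot u1_ge0 u2_ge0 d12 gt0.
  exact: gauge_ge0_pivot.
(* Exchanging the indices 1 and 2 moves the pivot to u2. *)
have -> : gauge p1 p2 p3 q12 q13 q23 r12 r13 r23 u1 u2 u3 u12 u13 u23
  = gauge p2 p1 p3 q12 q23 q13 r12 r23 r13 u2 u1 u3 u12 u23 u13.
  by rewrite /gauge; ring.
have tw21 t : - (Num.sqrt p2 * Num.sqrt p1 * `|t|) <= twist q12 r12 t.
  by rewrite [Num.sqrt p2 * _]mulrC.
apply: gauge_ge0_pivot => //.
- by move=> x y z; have := psdU y x z; rewrite /quad3; lra.
- by rewrite mulrAC.
- by rewrite mulrAC.
- by move=> x y z; have := H y x z; rewrite /gauge [y * x]mulrC; lra.
Qed.

End Cone.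

(** * Symmetries and multilinear expansion of the tensors *)

Lemma in_W_sym (R : realType) (U : vectType R) (S : tensor4 U) : in_W S ->
  [/\ forall a b c d, ev4 S b a d c = ev4 S a b c d,
      forall a b c d, ev4 S c d a b = ev4 S a b c d
    & forall a b c d, ev4 S a d c b = ev4 S a b c d].
Proof.
case=> [[A [B [[A1 A2 A3] [B1 B2 B3] ->]]] tauS].
have evD a b c d : ev4 (A + B) a b c d = ev4 A a b c d + ev4 B a b c d.
  by rewrite /ev4 !add_lfunE.
split=> a b c d; last exact: tauS.
- by rewrite !evD A1 A2 B1 B2 opprK.
- by rewrite !evD A3 B3.
Qed.

Section Ev4.
Variables (R : realType) (U : vectType R).
Implicit Type T : tensor4 U.

Lemma ev4_sum1 T n (a : 'I_n -> R) (x : 'I_n -> U) b c d :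
  ev4 T (\sum_i a i *: x i) b c d = \sum_i a i * ev4 T (x i) b c d.
Proof.
rewrite /ev4 linear_sum !sum_lfunE; apply: eq_bigr => i _.
by rewrite linearZ !scale_lfunE.
Qed.

Lemma ev4_sum2 T n (a : 'I_n -> R) (x : 'I_n -> U) b c d :
  ev4 T b (\sum_i a i *: x i) c d = \sum_i a i * ev4 T b (x i) c d.
Proof.
rewrite /ev4 linear_sum !sum_lfunE; apply: eq_bigr => i _.
by rewrite linearZ !scale_lfunE.
Qed.

Lemma ev4_sum3 T n (a : 'I_n -> R) (x : 'I_n -> U) b c d :
  ev4 T b c (\sum_i a i *: x i) d = \sum_i a i * ev4 T b c (x i) d.
Proof.
rewrite /ev4 linear_sum !sum_lfunE; apply: eq_bigr => i _.
by rewrite linearZ !scale_lfunE.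
Qed.

Lemma ev4_sum4 T n (a : 'I_n -> R) (x : 'I_n -> U) b c d :
  ev4 T b c d (\sum_i a i *: x i) = \sum_i a i * ev4 T b c d (x i).
Proof.
by rewrite /ev4 linear_sum; apply: eq_bigr => i _; rewrite linearZ.
Qed.

Lemma ev4_expand T n (x : 'I_n -> U) (a b c d : 'I_n -> R) :
  ev4 T (\sum_i a i *: x i) (\sum_i b i *: x i)
        (\sum_i c i *: x i) (\sum_i d i *: x i)
  = \sum_i \sum_j \sum_k \sum_l
      ev4 T (x i) (x j) (x k) (x l) * (a i * b j * c k * d l).
Proof.
rewrite ev4_sum1; apply: eq_bigr => i _.
rewrite ev4_sum2 mulr_sumr; apply: eq_bigr => j _.
rewrite ev4_sum3 !mulr_sumr; apply: eq_bigr => k _.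
rewrite ev4_sum4 !mulr_sumr; apply: eq_bigr => l _; ring.
Qed.

Lemma ev4_scale T k1 k2 k3 k4 a b c d :
  ev4 T (k1 *: a) (k2 *: b) (k3 *: c) (k4 *: d)
  = k1 * k2 * k3 * k4 * ev4 T a b c d.
Proof.
rewrite /ev4 !linearZ_LR /= !scale_lfunE.
by rewrite /GRing.scale /=; ring.
Qed.

End Ev4.

(** * Pure tensors and necessity of the elastic bounds *)

Section Rank1.
Variables (R : realType) (V : vectType R).

Definition tens_fun (T : vectType R) (f : dual V) (w : T) (x : V) : T := (f x : R) *: w.

Fact tens_fun_linear (T : vectType R) (f : dual V) (w : T) : linear (tens_fun f w).
Proof. by move=> k x y; rewrite /tens_fun linearP scalerDl scalerA. Qed.

HB.instance Definition _ (T : vectType R) (f : dual V) (w : T) :=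
  GRing.isLinear.Build R V T _ (tens_fun f w) (tens_fun_linear f w).

Definition tens (T : vectType R) (f : dual V) (w : T) : 'Hom(V, T) :=
  linfun (tens_fun f w).

Lemma tensE (T : vectType R) (f : dual V) (w : T) x : tens f w x = (f x : R) *: w.
Proof. by rewrite lfunE. Qed.

Definition pure4 (f1 f2 f3 f4 : dual V) : tensor4 V :=
  tens f1 (tens f2 (tens f3 f4)).

Lemma pure4E f1 f2 f3 f4 a b c d :
  ev4 (pure4 f1 f2 f3 f4) a b c d = (f1 a : R) * f2 b * f3 c * f4 d.
Proof.
rewrite /ev4 /pure4 tensE !scale_lfunE tensE !scale_lfunE tensE scale_lfunE.
by rewrite /GRing.scale /= !mulrA.
Qed.

Lemma pairingD (M : tensor4 (dual V)) S S' :
  pairing M (S + S') = pairing M S + pairing M S'.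
Proof.
rewrite /pairing /pairing_on; do 4!(rewrite -big_split; apply: eq_bigr => ? _) => /=.
by rewrite -mulrDr /ev4 !add_lfunE.
Qed.

Lemma pairing_pure4 (M : tensor4 (dual V)) f1 f2 f3 f4 :
  pairing M (pure4 f1 f2 f3 f4) = ev4 M f1 f2 f3 f4.
Proof.
have bb := vbasisP {:V}.
rewrite [in RHS](dual_expand f1 bb) [in RHS](dual_expand f2 bb).
rewrite [in RHS](dual_expand f3 bb) [in RHS](dual_expand f4 bb) ev4_expand.
by do 4!(apply: eq_bigr => ? _); rewrite pure4E.
Qed.

(* Up to normalization, the projection to W of the square of the functional a⊗b. *)
Definition square_in_W (a b : dual V) : tensor4 V := pure4 a b a b + pure4 b a b a.

Lemma square_in_WE a b x y z t : ev4 (square_in_W a b) x y z t =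
  (a x : R) * b y * a z * b t + (b x : R) * a y * b z * a t.
Proof. by rewrite -!pure4E /ev4 !add_lfunE. Qed.

Lemma square_in_CW a b : in_CW (square_in_W a b).
Proof.
pose c : R := 2^-1.
have c2 : c + c = 1 by rewrite /c; lra.
split; first split.
(* [square_in_W a b] ± T is the square of a⊗b ± b⊗a, so halving gives the symmetric and the
   alternating component. *)
- pose T := pure4 a b b a + pure4 b a a b.
  have evT x y z t : ev4 T x y z t =
      (a x : R) * b y * b z * a t + (b x : R) * a y * a z * b t.
    by rewrite -!pure4E /ev4 !add_lfunE.
  have evZ (k : R) (P : tensor4 V) x y z t : ev4 (k *: P) x y z t = k * ev4 P x y z t.
    by rewrite /ev4 !scale_lfunE.
  have evD (P P' : tensor4 V) x y z t :
      ev4 (P + P') x y z t = ev4 P x y z t + ev4 P' x y z t.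
    by rewrite /ev4 !add_lfunE.
  exists (c *: (square_in_W a b + T)), (c *: (square_in_W a b + (-1) *: T)); split.
  + by split=> x y z t; rewrite !(evZ, evD, evT, square_in_WE); ring.
  + by split=> x y z t; rewrite !(evZ, evD, evT, square_in_WE); ring.
  + by rewrite -scalerDr addrACA scaleN1r subrr addr0 scalerDr -scalerDl c2 scale1r.
- by move=> x y z t; rewrite !square_in_WE; ring.
- move=> x; rewrite /form2.
  pose A := \sum_(p <- x) (a p.1 : R) * b p.2; pose B := \sum_(p <- x) (b p.1 : R) * a p.2.
  suff -> : \sum_(p <- x) \sum_(q <- x) ev4 (square_in_W a b) p.1 p.2 q.1 q.2
          = A ^+ 2 + B ^+ 2 by rewrite addr_ge0 ?sqr_ge0.
  rewrite !expr2 {1}/A {1}/B !mulr_suml -big_split; apply: eq_bigr => p _ /=.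
  rewrite !mulr_sumr -big_split; apply: eq_bigr => q _ /=.
  by rewrite square_in_WE; ring.
Qed.

Lemma dual_CW_elastic (M : tensor4 (dual V)) : in_dual_CW M -> elastic_bounds M.
Proof.
move=> [/in_W_sym[M1 _ _] Mge0] a b; rewrite /form2 !big_seq1 /=.
have := Mge0 _ (square_in_CW a b).
by rewrite pairingD !pairing_pure4 M1; lra.
Qed.

End Rank1.

(** * Sign-invariant tensors in coordinates *)

Section Even.
Variable R : realType.

Definition sgn3 (k i : 'I_3) : R := if i == k then -1 else 1.

Let o0 : 'I_3 := @Ordinal 3 0 isT.
Let o1 : 'I_3 := @Ordinal 3 1 isT.
Let o2 : 'I_3 := @Ordinal 3 2 isT.

Lemma sum_ord3 (F : 'I_3 -> R) : \sum_i F i = F o0 + F o1 + F o2.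
Proof.
rewrite !big_ord_recl big_ord0 addr0 addrA.
by congr (F _ + F _ + F _); apply: val_inj.
Qed.

Implicit Types m F : 'I_3 -> 'I_3 -> 'I_3 -> 'I_3 -> R.

Definition elastic_sym m := [/\ forall i j k l, m j i l k = m i j k l,
  forall i j k l, m k l i j = m i j k l & forall i j k l, m i l k j = m i j k l].

Definition flip_inv m := forall h i j k l,
  sgn3 h i * sgn3 h j * sgn3 h k * sgn3 h l * m i j k l = m i j k l.

Lemma elastic_sum m F : elastic_sym m -> flip_inv m ->
  \sum_i \sum_j \sum_k \sum_l m i j k l * F i j k l
  = m o0 o0 o0 o0 * F o0 o0 o0 o0 + m o1 o1 o1 o1 * F o1 o1 o1 o1
    + m o2 o2 o2 o2 * F o2 o2 o2 o2
  + m o0 o1 o0 o1 * (F o0 o1 o0 o1 + F o1 o0 o1 o0)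
  + m o0 o2 o0 o2 * (F o0 o2 o0 o2 + F o2 o0 o2 o0)
  + m o1 o2 o1 o2 * (F o1 o2 o1 o2 + F o2 o1 o2 o1)
  + m o0 o0 o1 o1 * (F o0 o0 o1 o1 + F o1 o1 o0 o0 + F o0 o1 o1 o0 + F o1 o0 o0 o1)
  + m o0 o0 o2 o2 * (F o0 o0 o2 o2 + F o2 o2 o0 o0 + F o0 o2 o2 o0 + F o2 o0 o0 o2)
  + m o1 o1 o2 o2 * (F o1 o1 o2 o2 + F o2 o2 o1 o1 + F o1 o2 o2 o1 + F o2 o1 o1 o2).
Proof.
move=> [m1 m2 m3] mE; rewrite !sum_ord3.
have Z h i j k l : sgn3 h i * sgn3 h j * sgn3 h k * sgn3 h l = -1 -> m i j k l = 0.
  by move=> s; have := mE h i j k l; rewrite s; lra.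
have Z' h i j k l : odd ((i == h) + (j == h) + (k == h) + (l == h)) -> m i j k l = 0.
  move=> od; apply: (Z h); move: od; rewrite /sgn3.
  by case: (i == h); case: (j == h); case: (k == h); case: (l == h) => //= _; ring.
(* [isT] is accepted only if the tried index value occurs an odd number of times, so exactly the
   entries with all multiplicities even survive. *)
do ![match goal with |- context [m ?i ?j ?k ?l] =>
  first [rewrite (@Z' o0 i j k l isT) | rewrite (@Z' o1 i j k l isT)
        | rewrite (@Z' o2 i j k l isT)] end].
have r1 i j : m j i j i = m i j i j by rewrite m1.
have r2 i j : m j j i i = m i i j j by rewrite m2.
have r3 i j : m i j j i = m i i j j by rewrite m3.
have r4 i j : m j i i j = m i i j j by rewrite m1 r3.
rewrite (r1 o0 o1) (r1 o0 o2) (r1 o1 o2) (r2 o0 o1) (r2 o0 o2) (r2 o1 o2).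
rewrite (r3 o0 o1) (r3 o0 o2) (r3 o1 o2) (r4 o0 o1) (r4 o0 o2) (r4 o1 o2).
rewrite !mul0r !(addr0, add0r).
ring.
Qed.

Lemma elastic_sum_ge0 m F :
  elastic_sym m -> flip_inv m -> elastic_sym F ->
  (forall a b : 'I_3 -> R,
     0 <= \sum_i \sum_j \sum_k \sum_l m i j k l * (a i * b j * a k * b l)) ->
  (forall y : 'I_3 -> R, 0 <= \sum_i \sum_j y i * y j * F i i j j) ->
  (forall i j, `|F i i j j| <= F i j i j) ->
  0 <= \sum_i \sum_j \sum_k \sum_l m i j k l * F i j k l.
Proof.
move=> mS mE [F1 F2 F3] bnd psdF offF.
have r1 i j : F j i j i = F i j i j by rewrite F1.
have r2 i j : F j j i i = F i i j j by rewrite F2.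
have r3 i j : F i j j i = F i i j j by rewrite F3.
have r4 i j : F j i i j = F i i j j by rewrite F1 r3.
have q_ge0 i j : 0 <= m i j i j.
  have := bnd (fun k => (k == i)%:R) (fun k => (k == j)%:R).
  rewrite (bigD1 i) //= [X in _ + X]big1 ?addr0; last first.
    by move=> k /negbTE nk; do 3!(apply: big1 => ? _); rewrite nk !mul0r mulr0.
  rewrite (bigD1 j) //= [X in _ + X]big1 ?addr0; last first.
    by move=> k /negbTE nk; do 2!(apply: big1 => ? _); rewrite nk mulr0 !mul0r mulr0.
  rewrite (bigD1 i) //= [X in _ + X]big1 ?addr0; last first.
    by move=> k /negbTE nk; apply: big1 => ? _; rewrite nk mulr0 mul0r mulr0.
  rewrite (bigD1 j) //= [X in _ + X]big1 ?addr0; last first.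
    by move=> k /negbTE nk; rewrite nk !mulr0.
  by rewrite !eqxx !mulr1.
rewrite elastic_sum //.
rewrite (r1 o0 o1) (r1 o0 o2) (r1 o1 o2) (r2 o0 o1) (r2 o0 o2) (r2 o1 o2).
rewrite (r3 o0 o1) (r3 o0 o2) (r3 o1 o2) (r4 o0 o1) (r4 o0 o2) (r4 o1 o2).
have w i j : m i j i j * `|F i i j j| <= m i j i j * F i j i j by exact: ler_wpM2l.
have := w o0 o1; have := w o0 o2; have := w o1 o2.
suff : 0 <= gauge (m o0 o0 o0 o0) (m o1 o1 o1 o1) (m o2 o2 o2 o2)
  (m o0 o1 o0 o1) (m o0 o2 o0 o2) (m o1 o2 o1 o2)
  (m o0 o0 o1 o1) (m o0 o0 o2 o2) (m o1 o1 o2 o2)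
  (F o0 o0 o0 o0) (F o1 o1 o1 o1) (F o2 o2 o2 o2)
  (F o0 o0 o1 o1) (F o0 o0 o2 o2) (F o1 o1 o2 o2) by rewrite /gauge /twist; lra.
apply: gauge_ge0 => x y z.
- (* Splitting v_i = a_i b_i with |a_i| = |b_i| makes a_i^2 b_j^2 = |v_i v_j|. *)
  pose v (i : 'I_3) := nth 0 [:: x; y; z] i.
  (* The boolean form lets [xchoose] select the signs as a function of i. *)
  have sgn_ex i : exists s, (s ^+ 2 == 1) && (s * v i == `|v i|).
    by have [s s1 sv] := sign_norm (v i); exists s; rewrite s1 sv !eqxx.
  pose s i := xchoose (sgn_ex i).
  have s2 i : s i ^+ 2 = 1 by have /andP[/eqP] := xchooseP (sgn_ex i).
  have sv i : s i * v i = `|v i| by have /andP[_ /eqP] := xchooseP (sgn_ex i).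
  pose a i := Num.sqrt `|v i|; pose b i := s i * a i.
  have aa i : a i * a i = `|v i| by rewrite -expr2 sqr_sqrtr.
  have bb i : b i * b i = `|v i| by rewrite mulrACA aa -expr2 s2 mul1r.
  have ab i : a i * b i = v i.
    by rewrite mulrCA aa -sv mulrA -expr2 s2 mul1r.
  have := bnd a b; rewrite elastic_sum //.
  have n2 i : `|v i| * `|v i| = v i * v i by rewrite -expr2 real_normK ?num_real.
  have E1 i j : a i * b j * a i * b j = `|v i| * `|v j|.
    by rewrite -mulrA mulrACA aa bb.
  have E2 i j : a i * b i * a j * b j = v i * v j by rewrite -(ab i) -(ab j); ring.
  have E3 i j : a i * b j * a j * b i = v i * v j.
    by rewrite -(ab i) -(ab j); ring.
  rewrite /gauge /twist !E1 !E2 !E3 !n2 /v /= !normrM; lra.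
- have := psdF (fun i : 'I_3 => nth 0 [:: x; y; z] i).
  by rewrite !sum_ord3 /= (r2 o0 o1) (r2 o0 o2) (r2 o1 o2) /quad3; lra.
Qed.

End Even.

(** * Passage from tensors to coordinates *)

Section Main.
Variables (R : realType) (V : vectType R).

Lemma dual_vec_flip (e : 3.-tuple V) (e_basis : basis_of {:V} e) (g : 'End(V)) k i :
  matrix_in e g = diag_mx (\row_j (if j == k then -1 else 1)) ->
  (dual_vec e i \o g)%VF = sgn3 R k i *: dual_vec e i.
Proof.
move=> /matrixP gE; rewrite [LHS](dual_expand _ e_basis) (bigD1 i) //= big1 ?addr0.
  by have := gE i i; rewrite comp_lfunE dual_vecE !mxE eqxx mulr1n => ->.
move=> j ji; have := gE i j; rewrite comp_lfunE dual_vecE !mxE [i == j]eq_sym (negbTE ji) => ->.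
by rewrite mulr0n scale0r.
Qed.

(** The test element is the sum of the y_i x_i⊗x_i. *)
Lemma psd_diag (S : tensor4 V) n (x : 'I_n -> V) (y : 'I_n -> R) : psd S ->
  0 <= \sum_i \sum_j y i * y j * ev4 S (x i) (x i) (x j) (x j).
Proof.
move=> /(_ [seq (y i *: x i, x i) | i <- enum 'I_n]).
rewrite /form2 big_map big_enum; under eq_bigr => i _.
  rewrite big_map big_enum /=; under eq_bigr => j _.
    rewrite -[X in ev4 _ _ X]scale1r -[X in ev4 _ _ _ _ X]scale1r ev4_scale !mulr1.
    over.
  over.
by [].
Qed.

(** On a⊗b ± b⊗a the form is 2 (S_abab ± S_aabb), because exchanging the second and fourth slots
    identifies S_abba with S_aabb. *)
Lemma psd_offdiag (S : tensor4 V) a b : in_W S -> psd S ->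
  `|ev4 S a a b b| <= ev4 S a b a b.
Proof.
move=> /in_W_sym[S1 S2 S3] psdS.
have := psdS [:: (a, b); (b, a)]; have := psdS [:: (a, b); (- 1 *: b, 1 *: a)].
have evN x y z t : ev4 S (-1 *: x) (1 *: y) z t = - ev4 S x y z t.
  by rewrite -[z]scale1r -[t]scale1r ev4_scale !scale1r; ring.
have evN' x y z t : ev4 S x y (-1 *: z) (1 *: t) = - ev4 S x y z t.
  by rewrite S2 evN S2.
rewrite /form2 !(big_cons, big_nil) /= !(evN, evN').
have E1 : ev4 S b a b a = ev4 S a b a b by rewrite S1.
have E2 : ev4 S a b b a = ev4 S a a b b by rewrite S3.
have E3 : ev4 S b a a b = ev4 S a a b b by rewrite S1 S3.
by rewrite E1 E2 E3 => h1 h2; rewrite ler_norml; apply/andP; split; lra.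
Qed.

End Main.

Theorem theorem5p6 (R : realType) (V : vectType R) (dimV : \dim {:V} = 3%N)
    (e : 3.-tuple V) (e_basis : basis_of {:V} e)
    (Q : 'I_3 -> 'End(V))
    (Q_mx : forall k : 'I_3,
       matrix_in e (Q k) = diag_mx (\row_j (if j == k then -1 else 1)))
    (M : tensor4 (dual V)) (M_W : in_W M)
    (M_inv : tensor_invariant (generated_by Q) M) :
  in_dual_CW M <-> elastic_bounds M.
Proof.
split=> [|bounds]; first exact: dual_CW_elastic.
split=> // S [S_W psdS]; rewrite (pairing_basisE _ _ e_basis) /pairing_on.
have [M1 M2 M3] := in_W_sym M_W; have [S1 S2 S3] := in_W_sym S_W.
apply: (elastic_sum_ge0
  (m := fun i j k l => ev4 M (dual_vec e i) (dual_vec e j) (dual_vec e k) (dual_vec e l))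
  (F := fun i j k l => ev4 S e`_i e`_j e`_k e`_l)).
- by split=> *; [exact: M1 | exact: M2 | exact: M3].
(* Precomposition with the generator [Q h] multiplies each dual basis vector by a sign, so
   invariance of M becomes [flip_inv]. *)
- move=> h i j k l; rewrite -ev4_scale -!(dual_vec_flip e_basis _ (Q_mx h)).
  exact: M_inv (gen_gen _ _) _ _ _ _.
- by split=> *; [exact: S1 | exact: S2 | exact: S3].
- move=> a b; rewrite -ev4_expand.
  have := bounds (\sum_i a i *: dual_vec e i) (\sum_i b i *: dual_vec e i).
  by rewrite /form2 !big_seq1.
- by move=> y; exact: psd_diag psdS.
- by move=> i j; exact: psd_offdiag.
Qed.
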